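(* Let $\mathbb{F}$ be a field of characteristic different from $2$ and $3$. The image of the map $\zeta_s:\mathcal{A}^c_3/SL(V)\to\Gamma_{\mathrm{Eisenstein}}$ induced by $m\mapsto(\tilde p_3(m),\tilde p_2(m),\mathrm{Disc}(Q_m),\mathrm{Inv}_m)$ is $$\Gamma^*_{\mathrm{Eisenstein}}=\{(A,B,D,C)\in\Gamma_{\mathrm{Eisenstein}}:D\ne0\}.$$
   Context: $V$ is a two-dimensional $\mathbb{F}$-vector space. $L=\Lambda^2(V^* )$ is the one-dimensional space of antisymmetric bilinear forms on $V$, $L^r$ its $r$-th tensor power, with $L^r\otimes L^s=L^{r+s}$. $\mathcal{A}^c$ is the set of symmetric bilinear maps $m:V\times V\to V$. $GL(V)$, and hence $SL(V)$, acts on $\mathcal{A}^c$ by $(g\cdot m)(v,w)=g\big(m(g^{-1}v,g^{-1}w)\big)$. Let $(e_1,e_2)$ be a basis of $V$ with dual basis $(\epsilon_1,\epsilon_2)$, put $\omega=\epsilon_1\wedge\epsilon_2$, and write $m(e_1,e_1)=ae_1+be_2$, $m(e_2,e_2)=ce_1+de_2$, $m(e_1,e_2)=ee_1+fe_2$. The fundamental cubic is $Q_m(v)=m(v,v)\wedge v$; thus $Q_m(xe_1+ye_2)=q(x,y)\,e_1\wedge e_2$ with $q(x,y)=-bx^3+(a-2f)x^2y+(2e-d)xy^2+cy^3$. Writing $q=A_0x^3+B_0x^2y+C_0xy^2+D_0y^3$, $\mathrm{Disc}(Q_m)=(18A_0B_0C_0D_0+B_0^2C_0^2-4A_0C_0^3-4B_0^3D_0-27A_0^2D_0^2)\,\omega^2\in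 L^2$. Put $\mu(x,y)=q_{xx}q_{yy}-q_{xy}^2$, $G(x,y)=q_x\mu_y-q_y\mu_x$, $\tau=(d+e,-(a+f))$. Define $\tilde p_3(m)=-8q(\tau)\omega^2\in L^2$, $\tilde p_2(m)=\mu(\tau)\omega^2\in L^2$, $\mathrm{Inv}_m=\frac1{54}G(\tau)\omega^3\in L^3$ (all independent of the basis and $SL(V)$-invariant). $\mathcal{A}^c_3=\{m\in\mathcal{A}^c:\mathrm{Disc}(Q_m)\ne0\}$, and $\Gamma_{\mathrm{Eisenstein}}=\{(A,B,D,C)\in(L^2\times L^2\times L^2\times L^3)\setminus\{0\}:27DA^2+4B^3+2^43^6C^2=0\}$. *)

(* Defs.v *)
From HB Require Import structures.
From mathcomp Require Import all_boot all_order all_algebra.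
From mathcomp Require Import boolp classical_sets functions.
From mathcomp Require Import mpoly.
From mathcomp Require Import ring.

Set Implicit Arguments.
Unset Strict Implicit.
Unset Printing Implicit Defensive.

Import GRing.Theory.
Local Open Scope ring_scope.
Local Open Scope classical_set_scope.

Section TensorPowers.
Context {F : fieldType} {V : vectType F}.

Definition antisym_forms : set (V -> V -> F^o) :=
  [set h | [/\ forall v, linear (h v), forall w, linear (h^~ w)
             & forall v w, h v w = - h w v]].

(** [L] is [antisym_forms]. For finite-dimensional [V], the tensor power of [r] copies of [L] is
    realized as the space of functions of [r] pairs of vectors that belong
    to [L] in each pair when the other pairs are fixed. *)
Definition pair_fun (r : nat) : Type := ('I_r -> V * V) -> F^o.

HB.instance Definition _ r := GRing.Lmodule.on (pair_fun r).

Definition Lpow (r : nat) : set (pair_fun r) :=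
  [set T : pair_fun r | forall (i : 'I_r) (x : 'I_r -> V * V),
     antisym_forms (fun v w => T [eta x with i |-> (v, w)])].

Definition tens r s (S : pair_fun r) (T : pair_fun s) : pair_fun (r + s) :=
  fun x => S (x \o lshift s) * T (x \o @rshift r s).

End TensorPowers.

Arguments pair_fun {F} V r.
Arguments Lpow {F} V r.

Local Notation "S ⊗ T" := (tens S T) (at level 40, left associativity).

Section Algebras.
Context {F : fieldType} {V : vectType F}.

Definition sym_bilinear : set 'Hom(V, 'Hom(V, V)) :=
  [set m : 'Hom(V, 'Hom(V, V)) | forall v w, m v w = m w v].

Definition GL_act (g : 'End(V)) (m : 'Hom(V, 'Hom(V, V))) :
    'Hom(V, 'Hom(V, V)) :=
  linfun (fun v => (g \o m (g^-1%VF v) \o g^-1)%VF).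

Lemma GL_actE g m v w : GL_act g m v w = g (m (g^-1%VF v) (g^-1%VF w)).
Proof.
have lin_f : linear (fun v => (g \o m (g^-1%VF v) \o g^-1)%VF).
  move=> c x y; apply/lfunP => z.
  by rewrite !(add_lfunE, scale_lfunE, comp_lfunE) !linearP
             !(add_lfunE, scale_lfunE) linearP.
pose f := HB.pack (fun v => (g \o m (g^-1%VF v) \o g^-1)%VF)
  (GRing.isLinear.Build _ _ _ _ _ lin_f) : {linear V -> 'Hom(V, V)}.
by rewrite /GL_act -/(f : V -> _) (lfunE f) /= !comp_lfunE.
Qed.

End Algebras.

Arguments sym_bilinear {F} V.

Section Invariants.
Context {F : fieldType} {V : vectType F}.
Variable e : 2.-tuple V.

Definition SL : set 'End(V) :=
  [set g | \det (\matrix_(i < 2, j < 2) coord e i (g e`_j)) = 1].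

Definition omega (v w : V) : F^o :=
  coord e 0 v * coord e 1 w - coord e 1 v * coord e 0 w.

Definition omega_pow (r : nat) : pair_fun V r :=
  fun x => \prod_(i < r) omega (x i).1 (x i).2.

Arguments omega_pow : clear implicits.

Lemma Lpow_omega_pow r : Lpow V r (omega_pow r).
Proof.
move=> i x.
have E v w : omega_pow r [eta x with i |-> (v, w)] =
    omega v w * \prod_(j < r | j != i) omega (x j).1 (x j).2.
  rewrite /omega_pow (bigD1 i) //= eqxx; congr (_ * _).
  by apply: eq_bigr => j /negPf ->.
split=> [v c a b|w c a b|v w]; rewrite !E /omega ?linearP /= /GRing.scale /=;
  by ring.
Qed.

Variable m : 'Hom(V, 'Hom(V, V)).

Definition coef_a : F := coord e 0 (m e`_0 e`_0).
Definition coef_b : F := coord e 1 (m e`_0 e`_0).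
Definition coef_c : F := coord e 0 (m e`_1 e`_1).
Definition coef_d : F := coord e 1 (m e`_1 e`_1).
Definition coef_e : F := coord e 0 (m e`_0 e`_1).
Definition coef_f : F := coord e 1 (m e`_0 e`_1).

Definition cubA : F := - coef_b.
Definition cubB : F := coef_a - 2%:R * coef_f.
Definition cubC : F := 2%:R * coef_e - coef_d.
Definition cubD : F := coef_c.

Definition point (x y : F) : 'I_2 -> F := fun i => if i == 0 then x else y.

Definition tau : 'I_2 -> F :=
  point (coef_d + coef_e) (- (coef_a + coef_f)).

Definition cubic : {mpoly F[2]} :=
  cubA *: 'X_0 ^+ 3 + cubB *: ('X_0 ^+ 2 * 'X_1)
  + cubC *: ('X_0 * 'X_1 ^+ 2) + cubD *: 'X_1 ^+ 3.

(** [cubic] is the coordinate expression of [v |-> m(v,v) /\ v]: the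
    coefficient of [u /\ v] on [e1 /\ e2] is [omega u v]. *)
Lemma fundamental_cubicE (x y : F) : basis_of {:V} e -> sym_bilinear V m ->
  let v := x *: e`_0 + y *: e`_1 in
  omega (m v v) v = cubic.@[point x y].
Proof.
move=> e_basis m_sym /=; have e_free := basis_free e_basis.
have e00 : coord e 0 e`_0 = 1 := coord_free 0 0 e_free.
have e10 : coord e 1 e`_0 = 0 := coord_free 0 1 e_free.
have e01 : coord e 0 e`_1 = 0 := coord_free 1 0 e_free.
have e11 : coord e 1 e`_1 = 1 := coord_free 1 1 e_free.
rewrite /omega /cubic !(mevalD, mevalZ, mevalM, rmorphXn, mevalXU) /=.
do !rewrite ?linearD ?linearZ ?add_lfunE ?scale_lfunE /=.
rewrite (m_sym e`_1 e`_0) e00 e10 e01 e11 /point /=.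
rewrite /cubA /cubB /cubC /cubD /coef_a /coef_b /coef_c /coef_d /coef_e /coef_f.
rewrite /GRing.scale /=.
by ring.
Qed.

Definition hess : {mpoly F[2]} :=
  cubic^`M(0)^`M(0) * cubic^`M(1)^`M(1) - cubic^`M(0)^`M(1) ^+ 2.

Definition jac : {mpoly F[2]} :=
  cubic^`M(0) * hess^`M(1) - cubic^`M(1) * hess^`M(0).

Definition Disc_Q : pair_fun V 2 :=
  (18%:R * cubA * cubB * cubC * cubD + cubB ^+ 2 * cubC ^+ 2
   - 4%:R * cubA * cubC ^+ 3 - 4%:R * cubB ^+ 3 * cubD
   - 27%:R * cubA ^+ 2 * cubD ^+ 2) *: omega_pow 2.

Definition p3 : pair_fun V 2 := (- 8%:R * cubic.@[tau]) *: omega_pow 2.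
Definition p2 : pair_fun V 2 := hess.@[tau] *: omega_pow 2.
Definition Inv_m : pair_fun V 3 := (54%:R^-1 * jac.@[tau]) *: omega_pow 3.

End Invariants.

Section Quotient.
Context {F : fieldType} {V : vectType F}.
Variable e : 2.-tuple V.

Definition algebras3 : set 'Hom(V, 'Hom(V, V)) :=
  [set m | sym_bilinear V m /\ Disc_Q e m <> 0].

Definition SL_orbit (m : 'Hom(V, 'Hom(V, V))) : set 'Hom(V, 'Hom(V, V)) :=
  [set GL_act g m | g in SL e].

Definition algebras3_mod_SL : set (set 'Hom(V, 'Hom(V, V))) :=
  [set SL_orbit m | m in algebras3].

End Quotient.

Section Eisenstein.
Context {F : fieldType} (V : vectType F).

Definition quad : Type :=
  (pair_fun V 2 * pair_fun V 2 * pair_fun V 2 * pair_fun V 3)%type.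

(** The entries of a quadruple are in the order (A, B, D, C). *)
Definition Gamma_Eisenstein : set quad :=
  [set p : quad | let: (A, B, D, C) := p in
    [/\ [/\ Lpow V 2 A, Lpow V 2 B, Lpow V 2 D & Lpow V 3 C],
        (A, B, D, C) <> (0, 0, 0, 0)
      & 27%:R *: (D ⊗ A ⊗ A) + 4%:R *: (B ⊗ B ⊗ B)
        + (2 ^ 4 * 3 ^ 6)%:R *: (C ⊗ C) = 0 :> pair_fun V 6]].

Definition Gamma_Eisenstein_star : set quad :=
  [set p | Gamma_Eisenstein p /\ p.1.2 <> 0].

End Eisenstein.

Arguments Gamma_Eisenstein {F} V.
Arguments Gamma_Eisenstein_star {F} V.

(* Main.v *)
Require Import Defs.
From HB Require Import structures.
From mathcomp Require Import all_boot all_order all_algebra.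
From mathcomp Require Import boolp classical_sets functions.
From mathcomp Require Import mpoly.
From mathcomp Require Import ring.

Import GRing.Theory.
Local Open Scope ring_scope.
Local Open Scope classical_set_scope.

(** In the basis [e] an algebra [m] amounts to six scalars, and these are
    equivalent to a binary cubic [q] (the fundamental cubic) together with a
    point [tau], by a linear change of variables that is invertible because
    [3] is.  The four invariants are [Disc q] and the values at [tau] of the
    covariants [q], [hess q] and [jac q], up to constants.  Everything then
    reduces to classical facts on one binary cubic and one point.

    - An element [g] of [SL] acts by [q |-> q \o g^-1] and [tau |-> g tau], and
      covariants are compatible with substitutions up to a power of the
      determinant ([cubic_of_GL_act], [hess_subst], [jac_subst],
      [disc_subst]).  So the four invariants are constant on [SL]-orbits and
      the map on the quotient exists.

    - The classical syzygy [432 Disc(q) q^2 + hess(q)^3 + jac(q)^2 = 0]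
      ([cubic_syzygy]) is, after rescaling, the equation of the Eisenstein
      cone.  So the image lies in the cone.

    - Conversely, let [(a, b, d, c)] satisfy the equation with [d != 0]
      ([Eisenstein_realized]).  If [tau] is nonzero, [SL] can move it to
      [(1, 0)], and a further shear kills one coefficient of the cubic: the
      remaining coefficients are read off from [a], [b] and [c] when [a != 0],
      and from [b], [c] and [d] when [a = 0] and [b != 0].  When [a = b = 0]
      the equation gives [c = 0], and [tau = 0] with any cubic of discriminant
      [d] will do.

    The passage between tensors and scalars is [LpowE]: [L] is a line spanned by
    [omega], and likewise each tensor power of it. *)

(** * Binary cubics and their covariants *)

Section BinaryCubics.
Context {R : comNzRingType}.
Implicit Types A B C D x y p r s t : R.

Definition cubic_val A B C D x y :=
  A * x ^+ 3 + B * (x ^+ 2 * y) + C * (x * y ^+ 2) + D * y ^+ 3.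

Definition hess_val A B C D x y :=
  (6%:R * A * x + 2%:R * B * y) * (2%:R * C * x + 6%:R * D * y)
  - (2%:R * B * x + 2%:R * C * y) ^+ 2.

(** The Jacobian determinant of the cubic and of its Hessian; the long factors
    are the partial derivatives of [hess_val] in [y] and in [x]. *)
Definition jac_val A B C D x y :=
  (3%:R * A * x ^+ 2 + 2%:R * B * x * y + C * y ^+ 2)
  * (2%:R * B * (2%:R * C * x + 6%:R * D * y)
     + 6%:R * D * (6%:R * A * x + 2%:R * B * y)
     - 4%:R * C * (2%:R * B * x + 2%:R * C * y))
  - (B * x ^+ 2 + 2%:R * C * x * y + 3%:R * D * y ^+ 2)
  * (6%:R * A * (2%:R * C * x + 6%:R * D * y)
     + 2%:R * C * (6%:R * A * x + 2%:R * B * y)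
     - 4%:R * B * (2%:R * B * x + 2%:R * C * y)).

Definition disc_val A B C D :=
  18%:R * A * B * C * D + B ^+ 2 * C ^+ 2 - 4%:R * A * C ^+ 3
  - 4%:R * B ^+ 3 * D - 27%:R * A ^+ 2 * D ^+ 2.

Lemma cubic_syzygy A B C D x y :
  432%:R * disc_val A B C D * cubic_val A B C D x y ^+ 2
  + hess_val A B C D x y ^+ 3 + jac_val A B C D x y ^+ 2 = 0.
Proof. rewrite /disc_val /cubic_val /hess_val /jac_val; ring. Qed.

(** The four arguments of [f] are the coefficients of the substituted cubic
    [q (p x + s y, r x + t y)]. *)
Definition subst_cubic {T : Type} (f : R -> R -> R -> R -> T)
    p r s t A B C D :=
  f (cubic_val A B C D p r)
    (3%:R * A * p ^+ 2 * s + B * (p ^+ 2 * t + 2%:R * p * r * s)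
     + C * (2%:R * p * r * t + r ^+ 2 * s) + 3%:R * D * r ^+ 2 * t)
    (3%:R * A * p * s ^+ 2 + B * (s ^+ 2 * r + 2%:R * p * s * t)
     + C * (2%:R * r * s * t + p * t ^+ 2) + 3%:R * D * r * t ^+ 2)
    (cubic_val A B C D s t).

Lemma disc_subst p r s t A B C D :
  subst_cubic disc_val p r s t A B C D
  = (p * t - r * s) ^+ 6 * disc_val A B C D.
Proof. rewrite /subst_cubic /disc_val /cubic_val; ring. Qed.

Lemma cubic_subst p r s t A B C D x y :
  subst_cubic cubic_val p r s t A B C D x y
  = cubic_val A B C D (p * x + s * y) (r * x + t * y).
Proof. rewrite /subst_cubic /cubic_val; ring. Qed.

Lemma hess_subst p r s t A B C D x y :
  subst_cubic hess_val p r s t A B C D x y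
  = (p * t - r * s) ^+ 2
    * hess_val A B C D (p * x + s * y) (r * x + t * y).
Proof. rewrite /subst_cubic /hess_val /cubic_val; ring. Qed.

Lemma jac_subst p r s t A B C D x y :
  subst_cubic jac_val p r s t A B C D x y
  = (p * t - r * s) ^+ 3
    * jac_val A B C D (p * x + s * y) (r * x + t * y).
Proof. rewrite /subst_cubic /jac_val /cubic_val; ring. Qed.

End BinaryCubics.

(** * The scalar equation of the Eisenstein cone and its solutions *)

Definition on_Eisenstein {F : fieldType} (a b d c : F) :=
  27%:R * (d * a * a) + 4%:R * (b * b * b) + (2 ^ 4 * 3 ^ 6)%:R * (c * c) = 0.

Section Realization.
Context {F : fieldType}.
Hypothesis char2 : 2%N \notin [pchar F].
Hypothesis char3 : 3%N \notin [pchar F].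

(** All numerical denominators of the development are of this form. *)
Lemma pow23_neq0 i j : (2 ^ i * 3 ^ j)%:R != 0 :> F.
Proof.
have n2 : 2%:R != 0 :> F by move: char2; apply: contra => n0; rewrite inE n0.
have n3 : 3%:R != 0 :> F by move: char3; apply: contra => n0; rewrite inE n0.
by rewrite natrM !natrX mulf_neq0 ?expf_neq0.
Qed.

Lemma covariants_on_Eisenstein (A B C D x y : F) :
  on_Eisenstein (- 8%:R * cubic_val A B C D x y) (hess_val A B C D x y)
    (disc_val A B C D) (54%:R^-1 * jac_val A B C D x y).
Proof.
have n54 : 54%:R != 0 :> F := pow23_neq0 1 3.
rewrite /on_Eisenstein natrM !natrX.
transitivity (4%:R * (432%:R * disc_val A B C D * cubic_val A B C D x y ^+ 2
  + hess_val A B C D x y ^+ 3 + jac_val A B C D x y ^+ 2)).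
  by field.
by rewrite cubic_syzygy mulr0.
Qed.

(** At [tau = (1, 0)] the covariants are explicit in the coefficients.  For a
    cubic [A x^3 + C x y^2 + D y^3] the first two are [A] and [12 A C], and the
    Jacobian is [108 A^2 D].  For [B x^2 y + D y^3] they are [0], [- 4 B^2] and
    [8 B^3], while the discriminant is [- 4 B^3 D].  The witnesses solve these
    equations, and the remaining value is forced by the equation of the cone. *)
Lemma Eisenstein_realized (a b d c : F) : d != 0 -> on_Eisenstein a b d c ->
  exists A B C D x y,
    [/\ - 8%:R * cubic_val A B C D x y = a, hess_val A B C D x y = b,
        disc_val A B C D = d & 54%:R^-1 * jac_val A B C D x y = c].
Proof.
have n2 : 2%:R != 0 :> F := pow23_neq0 1 0.
have n3 : 3%:R != 0 :> F := pow23_neq0 0 1.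
have n4 : 4%:R != 0 :> F := pow23_neq0 2 0.
have n8 : 8%:R != 0 :> F := pow23_neq0 3 0.
have n27 : 27%:R != 0 :> F := pow23_neq0 0 3.
have n54 : 54%:R != 0 :> F := pow23_neq0 1 3.
move=> d0; rewrite /on_Eisenstein natrM !natrX => eis.
rewrite /cubic_val /hess_val /disc_val /jac_val.
have [a0|a0] := eqVneq a 0; last first.
  exists (- a / 8%:R), 0, (- 2%:R * b / (3%:R * a)), (32%:R * c / a ^+ 2), 1, 0.
  have -> : d = - (4%:R * (b * b * b) + 2%:R ^+ 4 * 3%:R ^+ 6 * (c * c))
                / (27%:R * a ^+ 2).
    apply: (canRL (mulfK _)); first by rewrite mulf_neq0 // expf_neq0.
    by apply/eqP; rewrite -subr_eq0 opprK -eis; apply/eqP; ring.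
  by split; field; rewrite ?n3 ?n8 ?n27 ?n54 ?a0.
have [b0|b0] := eqVneq b 0.
  have c0 : c = 0.
    move: eis; rewrite a0 b0 !(mulr0, add0r) => /eqP.
    by rewrite !mulf_eq0 (negPf n2) (negPf n3) /= orbb => /eqP.
  exists 0, 1, 0, (- d / 4%:R), 0, 0; rewrite a0 b0 c0.
  by split; field; rewrite ?n4 ?n54.
move: eis; rewrite a0 !mulr0 add0r => eis.
have c0 : c != 0.
  apply/eqP => c0; move: eis; rewrite c0 !(mulr0, addr0) => /eqP.
  by rewrite !mulf_eq0 (negPf n4) (negPf b0).
(* [8 B^3 = 54 c] and [- 4 B^2 = b] determine [B] as a quotient. *)
set B := - 27%:R * c / b.
have B0 : B != 0 by rewrite !mulf_neq0 ?oppr_eq0 ?invr_eq0.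
have B2 : - 4%:R * B ^+ 2 = b.
  rewrite /B; apply/eqP; rewrite -subr_eq0.
  have -> : - 4%:R * (- 27%:R * c / b) ^+ 2 - b
     = - (4%:R * (b * b * b) + 2%:R ^+ 4 * 3%:R ^+ 6 * (c * c))
       / (4%:R * b ^+ 2).
    by field; rewrite n4 b0.
  by rewrite eis oppr0 mul0r.
exists 0, B, 0, (- d / (4%:R * B ^+ 3)), 1, 0; split.
- by ring.
- by rewrite -B2; ring.
- by field; rewrite n4 B0.
have -> : c = - (B * b) / 27%:R by rewrite /B; field; rewrite n27 b0.
by rewrite -B2; field; rewrite ?n54 ?n27 ?n4 ?B0.
Qed.

End Realization.

(** * Coordinates in the plane *)

Section Coordinates.
Context {F : fieldType} {V : vectType F} (e : 2.-tuple V).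
Hypothesis e_basis : basis_of {:V} e.

Lemma basis_pair (v : V) : v = coord e 0 v *: e`_0 + coord e 1 v *: e`_1.
Proof.
rewrite {1}(coord_basis e_basis (memvf v)) !big_ord_recl big_ord0 addr0.
by congr (coord e _ _ *: _ + coord e _ _ *: _); exact: val_inj.
Qed.

Lemma pairD (x y x' y' : F) :
  (x *: e`_0 + y *: e`_1) + (x' *: e`_0 + y' *: e`_1)
  = (x + x') *: e`_0 + (y + y') *: e`_1.
Proof. by rewrite addrACA !scalerDl. Qed.

Lemma pairZ (k x y : F) :
  k *: (x *: e`_0 + y *: e`_1) = (k * x) *: e`_0 + (k * y) *: e`_1.
Proof. by rewrite scalerDr !scalerA. Qed.

Lemma coord_e : [/\ coord e 0 e`_0 = 1, coord e 1 e`_0 = 0,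
  coord e 0 e`_1 = 0 & coord e 1 e`_1 = 1].
Proof.
have e_free := basis_free e_basis.
split; [exact: (coord_free 0 0 e_free)|exact: (coord_free 0 1 e_free)
  |exact: (coord_free 1 0 e_free)|exact: (coord_free 1 1 e_free)].
Qed.

Lemma coord_pair (x y : F) :
  (coord e 0 (x *: e`_0 + y *: e`_1) = x)
  * (coord e 1 (x *: e`_0 + y *: e`_1) = y).
Proof.
have [e00 e10 e01 e11] := coord_e.
rewrite !linearD !linearZ /= e00 e10 e01 e11 /GRing.scale /=.
by split; ring.
Qed.

End Coordinates.

(** * Tensor powers of the line of antisymmetric forms *)

Section TensorPowers.
Context {F : fieldType} {V : vectType F} (e : 2.-tuple V).
Hypothesis e_basis : basis_of {:V} e.

Lemma antisym_formE (h : V -> V -> F^o) :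
    2%N \notin [pchar F] -> antisym_forms h ->
  forall v w, h v w = h e`_0 e`_1 * omega e v w.
Proof.
move=> char2 [hr hl ha] v w.
have n2 : 2%:R != 0 :> F by move: char2; apply: contra => n0; rewrite inE n0.
(* Antisymmetric forms are alternating since [2] is invertible. *)
have h0 u : h u u = 0.
  have /eqP := ha u u; rewrite -subr_eq0 opprK -mulr2n -mulr_natl mulf_eq0.
  by rewrite (negPf n2) => /eqP.
have hD u x y : h u (x + y) = h u x + h u y.
  by have := hr u 1 x y; rewrite !scale1r.
have hu0 u : h u 0 = 0 by apply: (addrI (h u 0)); rewrite -hD !addr0.
have hZ u k x : h u (k *: x) = k * h u x.
  by have := hr u k x 0; rewrite hu0 !addr0.
have Dr u x y x' y' : h u (x *: x' + y *: y') = x * h u x' + y * h u y'.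
  by rewrite hD !hZ.
have Dl x y x' y' u : h (x *: x' + y *: y') u = x * h x' u + y * h y' u.
  by rewrite ha Dr (ha u x') (ha u y'); ring.
rewrite {1}(basis_pair e e_basis v) {1}(basis_pair e e_basis w) Dr !Dl !h0.
by rewrite (ha e`_1 e`_0) /omega; ring.
Qed.

Definition base_pairs {r} : 'I_r -> V * V := fun=> (e`_0, e`_1).

(** [antisym_formE] applied in each slot in turn: the pairs of arguments in the
    slots [s] are replaced by the base pair, at the cost of a factor [omega]. *)
Lemma LpowE r (T : pair_fun V r) : 2%N \notin [pchar F] -> Lpow V r T ->
  T = T base_pairs *: @omega_pow _ _ e r.
Proof.
move=> char2 LT; apply/funext => x.
have replace_slots (s : seq 'I_r) : uniq s ->
    T x = T (fun i => if i \in s then (e`_0, e`_1) else x i)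
          * \prod_(i <- s) omega e (x i).1 (x i).2.
  elim: s => [_|i s IHs /= /andP[i_s us]].
    by rewrite big_nil mulr1.
  rewrite big_cons (IHs us) mulrA; congr (_ * _).
  set y : 'I_r -> V * V := fun j => if j \in s then (e`_0, e`_1) else x j.
  have -> : T y = T [eta y with i |-> ((x i).1, (x i).2)].
    congr (T _); apply/funext => j /=.
    by case: eqVneq => // ->; rewrite /y (negPf i_s); case: (x i).
  rewrite (antisym_formE _ char2 (LT i y)); congr (T _ * _).
  by apply/funext => j /=; rewrite inE /y; case: eqVneq.
rewrite (replace_slots _ (index_enum_uniq _)); congr (T _ * _).
by apply/funext => j; rewrite mem_index_enum.
Qed.

Lemma scale_omega_pow_inj r :
  injective (fun c : F => c *: @omega_pow _ _ e r).
Proof.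
have omega1 : @omega_pow _ _ e r base_pairs = 1.
  have [e00 e10 e01 e11] := coord_e e e_basis.
  by rewrite /omega_pow big1 // => i _; rewrite /omega /= e00 e10 e01 e11; ring.
move=> c d /= /(congr1 (fun T : pair_fun V r => T base_pairs)).
by rewrite /= /GRing.scale /= omega1 /GRing.scale /= !mulr1.
Qed.

Lemma tens_omega_pow r s (c d : F) :
  tens (c *: @omega_pow _ _ e r) (d *: @omega_pow _ _ e s)
  = (c * d) *: @omega_pow _ _ e (r + s).
Proof.
apply/funext => x; rewrite /tens /GRing.scale /= /GRing.scale /=.
by rewrite mulrACA /omega_pow big_split_ord.
Qed.

Lemma Lpow_scale_omega_pow r (c : F) : Lpow V r (c *: @omega_pow _ _ e r).
Proof.
move=> i x; have [hr hl ha] := Lpow_omega_pow e i x.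
split=> [v k a b|w k a b|v w].
- by have /= := hr v k a b; rewrite /GRing.scale /= /GRing.scale /= => ->; ring.
- by have /= := hl w k a b; rewrite /GRing.scale /= /GRing.scale /= => ->; ring.
by have /= := ha v w; rewrite /GRing.scale /= /GRing.scale /= => ->; ring.
Qed.

Definition omega_quad (a b d c : F) : quad V :=
  (a *: @omega_pow _ _ e 2, b *: @omega_pow _ _ e 2,
   d *: @omega_pow _ _ e 2, c *: @omega_pow _ _ e 3).

Lemma Gamma_on_Eisenstein a b d c :
  Gamma_Eisenstein V (omega_quad a b d c) -> on_Eisenstein a b d c.
Proof.
case=> _ _; rewrite !tens_omega_pow !scalerA -!scalerDl => eis.
by apply: (scale_omega_pow_inj 6); rewrite scale0r.
Qed.

Lemma on_Eisenstein_Gamma a b d c : on_Eisenstein a b d c ->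
  d *: @omega_pow _ _ e 2 <> 0 -> Gamma_Eisenstein V (omega_quad a b d c).
Proof.
move=> eis d0; split; first by split; apply: Lpow_scale_omega_pow.
  by case.
by rewrite !tens_omega_pow !scalerA -!scalerDl [X in X *: _]eis scale0r.
Qed.

End TensorPowers.

(** * The invariants of an algebra in coordinates *)

Section Invariants.
Context {F : fieldType} {V : vectType F} (e : 2.-tuple V).
Implicit Types m : 'Hom(V, 'Hom(V, V)).

Definition on_cubic {T : Type} (f : F -> F -> F -> F -> T) m :=
  f (cubA e m) (cubB e m) (cubC e m) (cubD e m).

Definition tau0 m := coef_d e m + coef_e e m.
Definition tau1 m := - (coef_a e m + coef_f e m).

Lemma mderivU (i j : 'I_2) : ('X_j : {mpoly F[2]})^`M(i) = (i == j)%:R.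
Proof.
rewrite mderivX mnm1E eq_sym; case: eqVneq => [->|_]; last by rewrite scale0r.
rewrite scale1r -mpolyX0; congr 'X_[_].
by apply/mnmP => k; rewrite mnmBE subnn mnm0E.
Qed.

Definition mderivS := (mderivD, mderivZ, mderivM, exprS, expr0, mderivU,
  mul1r, mulr1, mul0r, mulr0, addr0, add0r).

Lemma mderiv_cubic0 m : (cubic e m)^`M(0) =
  (3%:R * cubA e m) *: 'X_0 ^+ 2 + (2%:R * cubB e m) *: ('X_0 * 'X_1)
  + cubC e m *: 'X_1 ^+ 2.
Proof. by rewrite /cubic !mderivS /= -!mul_mpolyC; ring. Qed.

Lemma mderiv_cubic1 m : (cubic e m)^`M(1) =
  cubB e m *: 'X_0 ^+ 2 + (2%:R * cubC e m) *: ('X_0 * 'X_1)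
  + (3%:R * cubD e m) *: 'X_1 ^+ 2.
Proof. by rewrite /cubic !mderivS /= -!mul_mpolyC; ring. Qed.

Lemma mderiv_quadratic (i : 'I_2) (p r s : F) :
  (p *: 'X_0 ^+ 2 + r *: ('X_0 * 'X_1) + s *: 'X_1 ^+ 2)^`M(i)
  = if i == 0 then (2%:R * p) *: 'X_0 + r *: 'X_1
    else r *: 'X_0 + (2%:R * s) *: 'X_1.
Proof.
have [->|->] : i = 0 \/ i = 1.
- by case: i => [[|[|//]] ?]; [left|right]; exact: val_inj.
- by rewrite !mderivS /= -!mul_mpolyC; ring.
by rewrite !mderivS /= -!mul_mpolyC; ring.
Qed.

(** The second derivatives as explicit linear forms, which keeps the third
    derivatives occurring in [jac] small. *)
Lemma hessE m : hess e m =
  ((6%:R * cubA e m) *: 'X_0 + (2%:R * cubB e m) *: 'X_1)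
  * ((2%:R * cubC e m) *: 'X_0 + (6%:R * cubD e m) *: 'X_1)
  - ((2%:R * cubB e m) *: 'X_0 + (2%:R * cubC e m) *: 'X_1) ^+ 2.
Proof.
by rewrite /hess mderiv_cubic0 mderiv_cubic1 !mderiv_quadratic /= !mulrA
           -!natrM.
Qed.

Definition mevalS := (mevalD, mevalN, mevalZ, mevalM, rmorphXn, mevalXU).

Lemma cubic_evalE m (x y : F) :
  (cubic e m).@[Defs.point x y] = on_cubic cubic_val m x y.
Proof. by rewrite /cubic !mevalS. Qed.

Lemma hess_evalE m (x y : F) :
  (hess e m).@[Defs.point x y] = on_cubic hess_val m x y.
Proof. by rewrite hessE !mevalS. Qed.

Lemma jac_evalE m (x y : F) :
  (jac e m).@[Defs.point x y] = on_cubic jac_val m x y.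
Proof.
rewrite /jac hessE mderiv_cubic0 mderiv_cubic1 expr2.
rewrite !(mderivD, mderivN, mderivM, mderivZ, mderivU) /=.
by rewrite !mevalS /= /on_cubic /jac_val /Defs.point /=; ring.
Qed.

Lemma invariantsE m : (p3 e m, p2 e m, Disc_Q e m, Inv_m e m) =
  omega_quad e (- 8%:R * on_cubic cubic_val m (tau0 m) (tau1 m))
    (on_cubic hess_val m (tau0 m) (tau1 m)) (on_cubic disc_val m)
    (54%:R^-1 * on_cubic jac_val m (tau0 m) (tau1 m)).
Proof. by rewrite /p3 /p2 /Inv_m cubic_evalE hess_evalE jac_evalE. Qed.

End Invariants.

(** * Invariance under the special linear group *)

Lemma det_mx2 (R : comNzRingType) (M : 'M[R]_2) :
  \det M = M 0 0 * M 1 1 - M 1 0 * M 0 1.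
Proof.
have lift00 : lift 0 0 = 1 :> 'I_2 by exact: val_inj.
have lift10 : lift 1 0 = 0 :> 'I_2 by exact: val_inj.
rewrite (expand_det_row _ 0) !big_ord_recl big_ord0 /cofactor !det_mx11 !mxE.
by rewrite !lift00 !lift10 /=; ring.
Qed.

Section Invariance.
Context {F : fieldType} {V : vectType F} (e : 2.-tuple V).
Hypothesis e_basis : basis_of {:V} e.
Implicit Types m : 'Hom(V, 'Hom(V, V)).

Lemma SL_columns (g : 'End(V)) : SL e g -> exists p r s t,
  [/\ p * t - r * s = 1, g e`_0 = p *: e`_0 + r *: e`_1 &
      g e`_1 = s *: e`_0 + t *: e`_1].
Proof.
rewrite /SL /=; set M := (X in \det X); move=> detM.
exists (M 0 0), (M 1 0), (M 0 1), (M 1 1).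
split; [by rewrite -detM det_mx2|by rewrite !mxE -basis_pair..].
Qed.

(** The inverse matrix is the adjugate.  For an arbitrary endomorphism, [g^-1] is
    only a generalized inverse; hence the computation of the kernel of [g]. *)
Lemma SL_inverse (g : 'End(V)) p r s t : p * t - r * s = 1 ->
    g e`_0 = p *: e`_0 + r *: e`_1 -> g e`_1 = s *: e`_0 + t *: e`_1 ->
  (g^-1)%VF e`_0 = t *: e`_0 - r *: e`_1 /\
  (g^-1)%VF e`_1 = - s *: e`_0 + p *: e`_1.
Proof.
move=> /(canRL (subrK _)) det1 ge0 ge1.
have gE x y : g (x *: e`_0 + y *: e`_1)
    = (p * x + s * y) *: e`_0 + (r * x + t * y) *: e`_1.
  rewrite linearD !linearZ /= ge0 ge1 !pairZ pairD.
  by congr (_ *: _ + _ *: _); ring.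
have g_inj : lker g == 0%VS.
  rewrite -subv0; apply/subvP => v.
  rewrite memv_ker memv0 {1 2}(basis_pair e e_basis v) gE.
  set x := coord _ _ _; set y := coord e 1 v => /eqP gv.
  have := coord_pair e e_basis (p * x + s * y) (r * x + t * y).
  rewrite gv !linear0 => -[h0 h1].
  have x0 : x = 0.
    have <- : t * (p * x + s * y) - s * (r * x + t * y) = x by ring: det1.
    by rewrite -h0 -h1 !mulr0 subr0.
  have y0 : y = 0.
    have <- : - r * (p * x + s * y) + p * (r * x + t * y) = y by ring: det1.
    by rewrite -h0 -h1 !mulr0 addr0.
  by rewrite x0 y0 !scale0r addr0.
split; apply: (lker0P g_inj); rewrite lker0_lfunVK // -?scaleNr gE.
  have -> : p * t + s * - r = 1 by ring: det1.
  have -> : r * t + t * - r = 0 by ring.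
  by rewrite scale1r scale0r addr0.
have -> : p * - s + s * p = 0 by ring.
have -> : r * - s + t * p = 1 by ring: det1.
by rewrite scale1r scale0r add0r.
Qed.

Lemma bilinear_pair m x y x' y' : sym_bilinear V m ->
  m (x *: e`_0 + y *: e`_1) (x' *: e`_0 + y' *: e`_1) =
    (x * x' * coef_a e m + (x * y' + y * x') * coef_e e m
     + y * y' * coef_c e m) *: e`_0
  + (x * x' * coef_b e m + (x * y' + y * x') * coef_f e m
     + y * y' * coef_d e m) *: e`_1.
Proof.
move=> m_sym.
have m00 : m e`_0 e`_0 = coef_a e m *: e`_0 + coef_b e m *: e`_1.
  exact: basis_pair.
have m11 : m e`_1 e`_1 = coef_c e m *: e`_0 + coef_d e m *: e`_1.
  exact: basis_pair.
have m01 : m e`_0 e`_1 = coef_e e m *: e`_0 + coef_f e m *: e`_1.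
  exact: basis_pair.
rewrite !linearD !linearZ /= !add_lfunE !scale_lfunE !linearD !linearZ /=.
rewrite (m_sym e`_1 e`_0) m00 m11 m01 !pairZ !pairD.
by congr (_ *: _ + _ *: _); ring.
Qed.

Lemma GL_act_coef (g : 'End(V)) m p r s t :
    sym_bilinear V m -> p * t - r * s = 1 ->
    g e`_0 = p *: e`_0 + r *: e`_1 -> g e`_1 = s *: e`_0 + t *: e`_1 ->
  let a := coef_a e m in let b := coef_b e m in let c := coef_c e m in
  let d := coef_d e m in let k := coef_e e m in let f := coef_f e m in
  let X x y x' y' := x * x' * a + (x * y' + y * x') * k + y * y' * c in
  let Y x y x' y' := x * x' * b + (x * y' + y * x') * f + y * y' * d in
  let gX x y x' y' := X x y x' y' * p + Y x y x' y' * s in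
  let gY x y x' y' := X x y x' y' * r + Y x y x' y' * t in
  let m' := GL_act g m in
  [/\ coef_a e m' = gX t (- r) t (- r), coef_b e m' = gY t (- r) t (- r),
      coef_c e m' = gX (- s) p (- s) p, coef_d e m' = gY (- s) p (- s) p &
      coef_e e m' = gX t (- r) (- s) p /\ coef_f e m' = gY t (- r) (- s) p].
Proof.
move=> m_sym det1 ge0 ge1 /=.
have [gi0 gi1] := SL_inverse _ _ _ _ _ det1 ge0 ge1.
rewrite /coef_a /coef_b /coef_c /coef_d /coef_e /coef_f !GL_actE gi0 gi1.
rewrite -scaleNr !bilinear_pair //.
have gE x y : g (x *: e`_0 + y *: e`_1)
    = (x * p + y * s) *: e`_0 + (x * r + y * t) *: e`_1.
  by rewrite linearD !linearZ /= ge0 ge1 !pairZ pairD.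
by rewrite !gE !(coord_pair e e_basis).
Qed.

(** For [g] of determinant [1], [g (m (h v, h v)) /\ v = m (h v, h v) /\ h v]
    with [h = g^-1]; so the cubic of [g m] is the substitution of [h] in the
    cubic of [m].  The point [tau] is carried along by [g], which is stated here
    as [h (tau (g m)) = tau m]. *)
Lemma cubic_of_GL_act (g : 'End(V)) m p r s t :
    sym_bilinear V m -> p * t - r * s = 1 ->
    g e`_0 = p *: e`_0 + r *: e`_1 -> g e`_1 = s *: e`_0 + t *: e`_1 ->
  [/\ forall T (f : F -> F -> F -> F -> T),
        on_cubic e f (GL_act g m) = on_cubic e (subst_cubic f t (- r) (- s) p) m,
      t * tau0 e (GL_act g m) + - s * tau1 e (GL_act g m) = tau0 e m &
      - r * tau0 e (GL_act g m) + p * tau1 e (GL_act g m) = tau1 e m].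
Proof.
move=> m_sym det1 ge0 ge1.
have [Ea Eb Ec Ed [Ee Ef]] := GL_act_coef g m p r s t m_sym det1 ge0 ge1.
have {}det1 := canRL (subrK _) det1.
split=> [T f||]; rewrite ?/tau0 ?/tau1 ?Ea ?Ed ?Ee ?Ef; try ring: det1.
rewrite /on_cubic /subst_cubic /cubA /cubB /cubC /cubD Ea Eb Ec Ed Ee Ef.
by rewrite /cubic_val; congr f; ring: det1.
Qed.

Lemma invariants_SL_orbit m m' : sym_bilinear V m -> SL_orbit e m m' ->
  (p3 e m', p2 e m', Disc_Q e m', Inv_m e m')
  = (p3 e m, p2 e m, Disc_Q e m, Inv_m e m).
Proof.
move=> m_sym [g /SL_columns[p [r [s [t [det1 ge0 ge1]]]]] <-].
have [cE t0E t1E] := cubic_of_GL_act g m p r s t m_sym det1 ge0 ge1.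
have det1' : t * p - - r * - s = 1 by rewrite mulrNN mulrC.
rewrite !invariantsE !cE /on_cubic cubic_subst hess_subst jac_subst disc_subst.
by rewrite det1' !expr1n !mul1r t0E t1E.
Qed.

Lemma SL_orbit_refl m : SL_orbit e m m.
Proof.
exists \1%VF.
  rewrite /SL /= det_mx2 !mxE !lfunE /=; have [-> -> -> ->] := coord_e e e_basis.
  by rewrite mulr1 mul0r subr0.
have inv1 v : (\1^-1)%VF v = v :> V.
  have id_inj : lker (\1%VF : 'End(V)) == 0%VS.
    by apply/lker0P => u w; rewrite !lfunE.
  by apply: (lker0P id_inj); rewrite lker0_lfunVK // lfunE.
by apply/lfunP => v; apply/lfunP => w; rewrite GL_actE lfunE /= !inv1.
Qed.

End Invariance.

(** * Algebras with a given cubic and a given point *)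

Section Construction.
Context {F : fieldType} {V : vectType F} (e : 2.-tuple V).
Hypothesis e_basis : basis_of {:V} e.

Lemma bilinear_hom (h : V -> V -> V) :
    (forall v, linear (h v)) -> (forall w, linear (h^~ w)) ->
  exists m : 'Hom(V, 'Hom(V, V)), forall v w, m v w = h v w.
Proof.
move=> hr hl.
pose h1 v := HB.pack (h v) (GRing.isLinear.Build _ _ _ _ _ (hr v))
  : {linear V -> V}.
have h1_lin : linear (fun v => linfun (h1 v)).
  move=> k x y; apply/lfunP => w.
  by rewrite !(add_lfunE, scale_lfunE, lfunE) /= hl.
pose h2 := HB.pack (fun v => linfun (h1 v))
  (GRing.isLinear.Build _ _ _ _ _ h1_lin) : {linear V -> 'Hom(V, V)}.
by exists (linfun h2) => v w; rewrite !lfunE.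
Qed.

Lemma algebra_with_coef (a b c d k f : F) :
  exists m, sym_bilinear V m /\
    [/\ coef_a e m = a, coef_b e m = b, coef_c e m = c, coef_d e m = d &
        coef_e e m = k /\ coef_f e m = f].
Proof.
pose s (x y z : F) (v w : V) : F := coord e 0 v * coord e 0 w * x
  + (coord e 0 v * coord e 1 w + coord e 1 v * coord e 0 w) * y
  + coord e 1 v * coord e 1 w * z.
have [| |m mE] :=
    bilinear_hom (fun v w => s a k c v w *: e`_0 + s b f d v w *: e`_1).
- move=> v l x y; rewrite pairZ pairD /s !linearP /= /GRing.scale /=.
  by congr (_ *: _ + _ *: _); ring.
- move=> v l x y; rewrite pairZ pairD /s !linearP /= /GRing.scale /=.
  by congr (_ *: _ + _ *: _); ring.
exists m; split.
  by move=> v w; rewrite !mE /s; congr (_ *: _ + _ *: _); ring.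
have [e00 e10 e01 e11] := coord_e e e_basis.
rewrite /coef_a /coef_b /coef_c /coef_d /coef_e /coef_f !mE.
rewrite !(coord_pair e e_basis) /s e00 e10 e01 e11.
by split; [ring..|split; ring].
Qed.

(** The pairs [(a - 2 f, a + f)] and [(2 e - d, d + e)] determine [(a, f)] and
    [(e, d)], both systems having determinant [3]. *)
Lemma algebra_with_cubic_tau (A B C D x y : F) : 3%:R != 0 :> F ->
  exists2 m, sym_bilinear V m &
    [/\ forall T (f : _ -> _ -> _ -> _ -> T), on_cubic e f m = f A B C D,
        tau0 e m = x & tau1 e m = y].
Proof.
move=> n3.
have [m [m_sym [Ea Eb Ec Ed [Ee Ef]]]] := algebra_with_coef
  ((B - 2%:R * y) / 3%:R) (- A) D ((2%:R * x - C) / 3%:R)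
  ((x + C) / 3%:R) (- (y + B) / 3%:R).
exists m => //.
rewrite /on_cubic /tau0 /tau1 /cubA /cubB /cubC /cubD Ea Eb Ec Ed Ee Ef.
by split=> [T f||]; [congr f|..]; field.
Qed.

End Construction.

(** * The image of the invariants *)

Theorem theorem7p4 (F : fieldType) (V : vectType F) (e : 2.-tuple V)
    (char2 : 2%N \notin [pchar F]) (char3 : 3%N \notin [pchar F])
    (dimV : \dim {:V} = 2%N) (e_basis : basis_of {:V} e) :
  exists zeta_s : {fun algebras3_mod_SL e >-> Gamma_Eisenstein V},
    (forall m, algebras3 e m ->
       zeta_s (SL_orbit e m) = (p3 e m, p2 e m, Disc_Q e m, Inv_m e m)) /\
    zeta_s @` algebras3_mod_SL e = Gamma_Eisenstein_star V.
Proof.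
pose inv m : quad V := (p3 e m, p2 e m, Disc_Q e m, Inv_m e m).
pose reps O := [set m | algebras3 e m /\ SL_orbit e m = O].
pose zeta O := inv (xget 0 (reps O)).
have zetaE m : algebras3 e m -> zeta (SL_orbit e m) = inv m.
  move=> m3; rewrite /zeta; set m' := xget _ _.
  have [_ m'm] : reps (SL_orbit e m) m' by apply: xgetPex; exists m.
  apply: (invariants_SL_orbit e e_basis _ _ m3.1).
  by rewrite -m'm; exact: SL_orbit_refl.
have inv_Gamma m : algebras3 e m -> Gamma_Eisenstein V (inv m).
  case=> _ disc0; rewrite /inv invariantsE.
  by apply: on_Eisenstein_Gamma disc0; exact: covariants_on_Eisenstein.
have zeta_Gamma :
    {homo zeta : O / algebras3_mod_SL e O >-> Gamma_Eisenstein V O}.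
  by move=> _ [m m3 <-]; rewrite zetaE //; exact: inv_Gamma.
exists (mkfun_fun zeta_Gamma); split=> [m m3|]; first exact: zetaE.
change (zeta @` algebras3_mod_SL e = Gamma_Eisenstein_star V).
apply/seteqP; split=> [_ [_ [m m3 <-] <-]|].
  by rewrite zetaE //; split; [exact: inv_Gamma|exact: m3.2].
move=> [[[A B] D] C] [GP /= D0].
have [[LA LB LD LC] _ _] := GP.
move: GP D0; rewrite (LpowE e e_basis _ _ char2 LA).
rewrite (LpowE e e_basis _ _ char2 LB) (LpowE e e_basis _ _ char2 LD).
rewrite (LpowE e e_basis _ _ char2 LC).
set a := A _; set b := B _; set d := D _; set c := C _ => eis D0.
have d0 : d != 0 by apply/eqP => d0; apply: D0; rewrite d0 scale0r.
have [qA [qB [qC [qD [x [y [Ea Eb Ed Ec]]]]]]] :=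
  Eisenstein_realized char2 char3 a b d c d0
    (Gamma_on_Eisenstein e e_basis a b d c eis).
have [m m_sym [qE xE yE]] := algebra_with_cubic_tau e e_basis
  qA qB qC qD x y (pow23_neq0 char2 char3 0 1).
have invE : inv m = omega_quad e a b d c.
  by rewrite /inv invariantsE !qE xE yE Ea Eb Ed Ec.
have m3 : algebras3 e m.
  by split=> //; rewrite -[Disc_Q e m]/(inv m).1.2 invE.
by exists (SL_orbit e m); [exists m|rewrite zetaE].
Qed.
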